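(* Let $b\ge 2$ be an integer. The dismal operations $\oplus_b$ (dismal addition) and $\otimes_b$ (dismal multiplication) on the set $A[X]$ of polynomials with coefficients in $A=\{0,1,\ldots,b-1\}$ satisfy the commutative and associative laws, and $\otimes_b$ distributes over $\oplus_b$.
   Context: Let $A=\{0,1,\ldots,b-1\}$ with operations $m\oplus_b n:=\max\{m,n\}$ and $m\otimes_b n:=\min\{m,n\}$ for $m,n\in A$. For polynomials $M(X)=\sum_{i=0}^{k-1}m_iX^i$ and $N(X)=\sum_{i=0}^{l-1}n_iX^i$ with coefficients in $A$ (missing coefficients being $0$), the dismal sum is $M\oplus_b N:=\sum_{i=0}^{\max\{k,l\}-1}\max\{m_i,n_i\}X^i$, and the dismal product is $M\otimes_b N:=\sum_{i=0}^{k+l-2}q_iX^i$, where $q_i:=\max\{\min\{m_j,n_{i-j}\}: 0\le j\le k-1,\ 0\le i-j\le l-1\}$. *)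

(* Defs.v *)
From HB Require Import structures.
From mathcomp Require Import all_boot.

Set Implicit Arguments.
Unset Strict Implicit.
Unset Printing Implicit Defensive.

(* The coefficients of M(X) = \sum_(i < k) m_i X^i are listed from degree 0   *)
(* upwards, so that k = size M.                                               *)

Definition dsum (M N : seq nat) : seq nat :=
  mkseq (fun i => maxn (nth 0 M i) (nth 0 N i)) (maxn (size M) (size N)).

Definition dprod (M N : seq nat) : seq nat :=
  mkseq
    (fun i => \max_(j < size M | (j <= i) && (i - j < size N))
                minn (nth 0 M j) (nth 0 N (i - j)))
    (size M + size N).-1.

(* Removes the trailing zeros, as MathComp's Poly does; MathComp's {poly R}   *)
(* itself presupposes the semiring laws of R.                                 *)
Definition trim : seq nat -> seq nat :=
  foldr (fun m s => if (m == 0) && nilp s then [::] else m :: s) [::].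

(* A[X] for A = {0, ..., b - 1}: without trailing zeros the coefficients      *)
(* determine the list, so Leibniz equality is equality of polynomials; the    *)
(* zero polynomial is [::].                                                   *)
Record dpoly (b : nat) := DPoly {
  dcoefs : seq nat;
  _ : all (fun m => m < b) dcoefs && (last 1 dcoefs != 0)
}.

HB.instance Definition _ (b : nat) := [isSub for @dcoefs b].
HB.instance Definition _ (b : nat) := [Equality of dpoly b by <:].

Lemma trim_dpoly (b : nat) (s : seq nat) :
  all (fun m => m < b) s ->
  all (fun m => m < b) (trim s) && (last 1 (trim s) != 0).
Proof.
elim: s => [|m s IHs] //= /andP[ltmb /IHs].
case: (trim s) => [_|n t]; last by rewrite andbF /= ltmb.
by case: eqP => [//|/eqP m_neq0] /=; rewrite ltmb.
Qed.

Lemma dcoefs_lt (b : nat) (M : dpoly b) : all (fun m => m < b) (dcoefs M).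
Proof. by case/andP: (valP M). Qed.

Lemma dsum_lt (b : nat) (M N : dpoly b) :
  all (fun m => m < b) (dsum (dcoefs M) (dcoefs N)).
Proof.
have [/all_nthP ltM /all_nthP ltN] := (dcoefs_lt M, dcoefs_lt N).
apply/(all_nthP 0) => i; rewrite size_mkseq => lti; rewrite nth_mkseq //.
have [ltiM|leMi] := ltnP i (size (dcoefs M));
  have [ltiN|leNi] := ltnP i (size (dcoefs N)).
- by rewrite gtn_max ltM ?ltN.
- by rewrite (nth_default _ leNi) maxn0 ltM.
- by rewrite (nth_default _ leMi) max0n ltN.
- by move: lti; rewrite leq_max ltnNge leMi ltnNge leNi.
Qed.

Lemma dprod_lt (b : nat) (M N : dpoly b) :
  all (fun m => m < b) (dprod (dcoefs M) (dcoefs N)).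
Proof.
have [/all_nthP ltM /all_nthP ltN] := (dcoefs_lt M, dcoefs_lt N).
apply/(all_nthP 0) => i; rewrite size_mkseq => lti; rewrite nth_mkseq //.
have b_gt0 : 0 < b.
  case: (ltnP 0 (size (dcoefs M))) => [/(ltM 0)|]; first exact: leq_ltn_trans.
  case: (ltnP 0 (size (dcoefs N))) => [/(ltN 0) h _|]; first exact: leq_ltn_trans h.
  by move: lti; case: (size (dcoefs N)) => //; case: (size (dcoefs M)).
apply: (big_ind (fun m => m < b)) => // [x y ltx lty | j _].
  by rewrite gtn_max ltx.
by rewrite gtn_min ltM.
Qed.

Definition dpoly_add (b : nat) (M N : dpoly b) : dpoly b :=
  DPoly (trim_dpoly (dsum_lt M N)).

Definition dpoly_mul (b : nat) (M N : dpoly b) : dpoly b :=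
  DPoly (trim_dpoly (dprod_lt M N)).

(* Main.v *)
Require Import Defs.
From mathcomp Require Import all_boot.

(** The maximum and the minimum of numbers become a disjunction and a
    conjunction once one asks which thresholds [t] lie strictly below them.  So
    a polynomial M is encoded by its level sets
    L_t(M) = {i | t < m_i}, one for each [t], and

    - the level sets determine M ([eq_levels]), because trailing zeros are
      removed and a number is determined by the numbers below it;
    - L_t of a dismal sum is the union of the L_t ([level_addE]);
    - L_t of a dismal product is the Minkowski sum of the L_t ([level_mulP]).

    Every law then holds level by level: union and Minkowski sum of sets of
    natural numbers are commutative and associative, and Minkowski sum
    distributes over union. *)

Lemma ltn_bigmaxP (I : finType) (P : pred I) (F : I -> nat) t :
  reflect (exists2 i, P i & t < F i) (t < \max_(i | P i) F i).
Proof.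
apply: (iffP idP) => [|[i Pi ltF]]; last first.
  exact: leq_trans ltF (leq_bigmax_cond _ Pi).
move=> lt_max; have /exists_inP[i Pi ltF] : [exists (i | P i), t < F i].
  apply: contraT; rewrite negb_exists_in => /forall_inP leF.
  move: lt_max; rewrite ltnNge => /negP[]; apply/bigmax_leqP => i /leF.
  by rewrite -leqNgt.
by exists i.
Qed.

Lemma nth_trim s i : nth 0 (trim s) i = nth 0 s i.
Proof.
elim: s i => [|m s IHs] i //=; case: ifP => [/andP[/eqP-> /nilP s0]|_].
  by case: i => [|i] //=; rewrite -IHs s0 !nth_nil.
by case: i => [|i] /=.
Qed.

(** Outside the range of indices computed by [dsum], both coefficients have
    their default value 0. *)
Lemma nth_dsum M N i : nth 0 (dsum M N) i = maxn (nth 0 M i) (nth 0 N i).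
Proof.
have [lti|lei] := ltnP i (maxn (size M) (size N)); first by rewrite nth_mkseq.
rewrite nth_default ?size_mkseq //.
by move: lei; rewrite geq_max => /andP[leM leN]; rewrite !nth_default.
Qed.

(** A coefficient exceeding some [t] is nonzero, so its index is in range; the
    size constraints in [dprod] are therefore automatic. *)
Lemma ltn_nth_dprodP M N t i :
  reflect (exists j k, [/\ i = j + k, t < nth 0 M j & t < nth 0 N k])
          (t < nth 0 (dprod M N) i).
Proof.
have in_range s j : t < nth 0 s j -> j < size s.
  by have [//|les] := ltnP j (size s); rewrite nth_default.
apply: (iffP idP) => [lt_t|[j [k [-> ltM ltN]]]].
  have:= lt_t; rewrite nth_mkseq; last first.
    by have:= in_range _ _ lt_t; rewrite size_mkseq.
  case/ltn_bigmaxP => j /andP[leji _]; rewrite leq_min => /andP[ltM ltN].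
  by exists j, (i - j); rewrite subnKC.
have [ltj ltk] := (in_range _ _ ltM, in_range _ _ ltN).
rewrite nth_mkseq; last first.
  case: (size M) ltj => // m lejm; case: (size N) ltk => // n lekn.
  by rewrite addSn addnS ltnS leq_add.
apply/ltn_bigmaxP; exists (Ordinal ltj) => /=; rewrite addKn ?leq_addr //.
by rewrite leq_min ltM.
Qed.

(** The last coefficient of a nonempty list without trailing zeros is nonzero,
    which is how the coefficients determine the size. *)
Lemma eq_dpoly {b} (M N : dpoly b) :
  (forall i, nth 0 (dcoefs M) i = nth 0 (dcoefs N) i) -> M = N.
Proof.
have le_size (P Q : dpoly b) :
    (forall i, nth 0 (dcoefs P) i = nth 0 (dcoefs Q) i) ->
  size (dcoefs P) <= size (dcoefs Q).
  move=> eqPQ; have lastP : last 1 (dcoefs P) != 0 by case/andP: (valP P).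
  rewrite leqNgt; apply/negP.
  have := eqPQ (size (dcoefs P)).-1; case: (dcoefs P) lastP => //= m s last_s.
  rewrite ltnS => nthQ leQ; move: nthQ; rewrite [RHS]nth_default //.
  by rewrite (last_nth 0) in last_s; apply/eqP.
move=> eqMN; apply: val_inj; apply: (@eq_from_nth _ 0) => //.
by apply/eqP; rewrite eqn_leq !le_size.
Qed.

Definition level {b} t (M : dpoly b) i := t < nth 0 (dcoefs M) i.

Lemma eq_levels {b} (M N : dpoly b) :
  (forall t i, level t M i = level t N i) -> M = N.
Proof.
move=> eqMN; apply: eq_dpoly => i; apply/eqP.
rewrite eqn_leq [X in X && _]leqNgt [X in _ && X]leqNgt.
(* Taking each of the two coefficients as threshold excludes that the other   *)
(* one is larger.                                                             *)
move: (eqMN (nth 0 (dcoefs N) i) i) (eqMN (nth 0 (dcoefs M) i) i).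
by rewrite /level !ltnn => -> <-.
Qed.

Lemma level_addE {b} t (M N : dpoly b) i :
  level t (dpoly_add M N) i = level t M i || level t N i.
Proof. by rewrite /level /= nth_trim nth_dsum leq_max. Qed.

Lemma level_mulP {b} t (M N : dpoly b) i :
  reflect (exists j k, [/\ i = j + k, level t M j & level t N k])
          (level t (dpoly_mul M N) i).
Proof. by rewrite /level /= nth_trim; apply: ltn_nth_dprodP. Qed.

Lemma dpoly_addC b : commutative (@dpoly_add b).
Proof. by move=> M N; apply: eq_levels => t i; rewrite !level_addE orbC. Qed.

Lemma dpoly_addA b : associative (@dpoly_add b).
Proof. by move=> M N P; apply: eq_levels => t i; rewrite !level_addE orbA. Qed.

Lemma dpoly_mulC b : commutative (@dpoly_mul b).
Proof.
move=> M N; apply: eq_levels => t i.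
apply/level_mulP/level_mulP => -[j [k [-> Lj Lk]]];
  by exists k, j; rewrite addnC.
Qed.

Lemma dpoly_mulA b : associative (@dpoly_mul b).
Proof.
move=> M N P; apply: eq_levels => t i; apply/level_mulP/level_mulP.
  move=> [j [_ [-> Lj /level_mulP[k [l [-> Lk Ll]]]]]].
  by exists (j + k), l; split; rewrite ?addnA //; apply/level_mulP; exists j, k.
move=> [_ [l [-> /level_mulP[j [k [-> Lj Lk]]] Ll]]].
by exists j, (k + l); split; rewrite ?addnA //; apply/level_mulP; exists k, l.
Qed.

Lemma dpoly_mulDl b : left_distributive (@dpoly_mul b) (@dpoly_add b).
Proof.
move=> M N P; apply: eq_levels => t i; rewrite level_addE.
apply/level_mulP/orP => [[j [k [-> + Lk]]]|].
  rewrite level_addE => /orP[] Lj; [left | right];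
    by apply/level_mulP; exists j, k.
case=> /level_mulP[j [k [-> Lj Lk]]];
  by exists j, k; rewrite level_addE Lj ?orbT.
Qed.

Lemma dpoly_mulDr b : right_distributive (@dpoly_mul b) (@dpoly_add b).
Proof. by move=> M N P; rewrite !(dpoly_mulC _ M) dpoly_mulDl. Qed.

Theorem theorem1 (b : nat) (hb : 2 <= b) :
  [/\ commutative (@dpoly_add b) /\ associative (@dpoly_add b),
      commutative (@dpoly_mul b) /\ associative (@dpoly_mul b)
    & left_distributive (@dpoly_mul b) (@dpoly_add b) /\
      right_distributive (@dpoly_mul b) (@dpoly_add b)].
Proof.
split; split.
- exact: dpoly_addC.
- exact: dpoly_addA.
- exact: dpoly_mulC.
- exact: dpoly_mulA.
- exact: dpoly_mulDl.
- exact: dpoly_mulDr.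
Qed.
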